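(* Let $\mathcal{A}$ be a spectral algebra, $0<p_0\le1$, $\omega$ an $(\mathcal{A},p_0)$-admissible weight, $T=(T_k)_{k\in X}$ a g-frame for $\mathcal{H}$ and $T^d=(T^d_k)_{k\in X}$ a dual g-frame of $T$ such that $T^d\sim_{\mathcal{A}}T$. Then for each $p\in(p_0,\infty]\cup\{0,1\}$, $$f=\sum_{k\in X}T_k^*T^d_kf\qquad\text{for all } f\in\mathcal{H}^p_\omega(T^d,T),$$ with unconditional convergence in $\mathcal{H}^p_\omega(T^d,T)$ for $p<\infty$ (including $p=0$), and unconditional convergence in the $\sigma(\mathcal{H},\mathcal{H}^{00}(T^d))$-topology in the case $p=\infty$.
   Context: $\mathcal{H}$ is a separable Hilbert space, $X\subset\mathbb{R}^d$ is countable; a weight is a continuous function $\omega:\mathbb{R}^d\to(0,\infty)$. g-frames. $T=(T_k)_{k\in X}\subset\mathcal{B}(\mathcal{H})$ is a g-frame if $A\|f\|^2\le\sum_k\|T_kf\|^2\le B\|f\|^2$ for all $f\in\mathcal H$ and some $0<A\le B<\infty$; it is g-Bessel if the upper bound holds. A dual g-frame of $T$ is a g-Bessel sequence $T^d=(T^d_k)_{k\in X}$ with $f=\sum_kT_k^*T^d_kf=\sum_k(T^d_k)^*T_kf$ for all $f\in\mathcal{H}$ (it is then itself a g-frame). $C_{T^d}f=(T^d_kf)_{k\in X}$, $D_T(f_k)_k=\sum_kT_k^*f_k$. Sequence spaces. For $0<p\le\infty$, $\ell^p_\omega(X;\mathcal{H})$ consists of $\mathcal{H}$-valued $(f_k)_{k\in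 X}$ with $\|(f_k)\|_{\ell^p_\omega(X;\mathcal H)}=\|(\|f_k\|\omega(k))_k\|_{\ell^p(X)}<\infty$. $\ell^{00}(X;\mathcal{H})$ is the space of finitely supported sequences and $\ell^0_\omega(X;\mathcal{H})$ its closure in $\ell^\infty_\omega(X;\mathcal{H})$, with the $\ell^\infty_\omega$-norm. Spectral algebra. A unital Banach *-algebra $\mathcal{A}$ of $\mathcal{B}(\mathcal{H})$-valued matrices $[A_{k,l}]_{k,l\in X}$ (matrix product, involution $[A_{k,l}]^*=[A_{l,k}^*]_{k,l}$, action $(Af)_k=\sum_lA_{k,l}f_l$) such that (1) $\mathcal{A}\subseteq\mathcal{B}(\ell^2(X;\mathcal{H}))$ via a unital *-monomorphism; (2) $A\in\mathcal{A}$ invertible in $\mathcal{B}(\ell^2(X;\mathcal{H}))$ implies $A^{-1}\in\mathcal{A}$; (3) $A\in\mathcal{A}$ and $\|B_{k,l}\|\le\|A_{k,l}\|$ for all $k,l$ imply $B\in\mathcal{A}$, $\|B\|_{\mathcal{A}}\le\|A\|_{\mathcal{A}}$. $U\sim_{\mathcal{A}}T$ means $G_{U,T}:=[U_kT_l^*]_{k,l\in X}\in\mathcal{A}$. A weight $\omega$ is $(\mathcal{A},p_0)$-admissible if every $A\in\mathcal{A}$ defines a bounded operator on $\ell^p_\omega(X;\mathcal{H})$ for every $p\in(p_0,\infty]\cup\{1\}$. The spaces $\mathcal{H}^p_\omega(T^d,T)$. Let $\mathcal{H}^{00}(T)=D_T(\ell^{00}(X;\mathcal{H}))$. For $p\in(p_0,\infty)\cup\{0,1\}$,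 $\mathcal{H}^p_\omega(T^d,T)$ is the completion of $\mathcal{H}^{00}(T)$ with respect to the (quasi-)norm $\|f\|_{\mathcal{H}^p_\omega(T^d,T)}=\|C_{T^d}f\|_{\ell^p_\omega(X;\mathcal{H})}$; $C_{T^d}$ (hence each $T^d_k$) extends by density to an isometry into $\ell^p_\omega(X;\mathcal{H})$. For $p=\infty$: two sequences $\{f_n\},\{g_n\}$ in $\mathcal{H}$ are $(T^d,\omega)$-equivalent ($\sim_{T^d,\omega}$) if $\lim_n\|T^d_k(f_n-g_n)\|=0$ for all $k\in X$ and $\sup_n\|C_{T^d}(f_n-g_n)\|_{\ell^\infty_\omega(X;\mathcal{H})}<\infty$. $\mathcal{H}^\infty_\omega(T^d,T)$ is the space of classes $f=[\{f_n\}]_{\sim_{T^d,\omega}}$ such that $T^d_kf:=\lim_nT^d_kf_n$ exists in $\mathcal{H}$ for each $k$ and $\sup_n\|C_{T^d}f_n\|_{\ell^\infty_\omega(X;\mathcal{H})}<\infty$, with norm $\sup_k\|T^d_kf\|\omega(k)$. Convergence for $p=\infty$. $\sigma(\mathcal{H},\mathcal{H}^{00}(T^d))$ is the locally convex topology on $\mathcal{H}$ given by the seminorms $h\mapsto|\langle g,h\rangle|$, $g\in\mathcal{H}^{00}(T^d)=D_{T^d}(\ell^{00}(X;\mathcal{H}))$; elements of $\mathcal{H}^\infty_\omega(T^d,T)$ are viewed in its completion. A series $\sum_{l\in X}h_l$ with $h_l\in\mathcal{H}$ converges unconditionally to $f=[\{f_n\}]$ in this topology if for every nested sequence $F_1\subseteq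 F_2\subseteq\cdots$ of finite subsets with union $X$ and every $g\in\mathcal{H}^{00}(T^d)$, $\lim_n\langle\sum_{l\in F_n}h_l,g\rangle=\lim_n\langle f_n,g\rangle$. As an element of $\mathcal{H}^\infty_\omega(T^d,T)$, $\sum_{l}T_l^*g_l$ (for $(g_l)\in\ell^\infty_\omega(X;\mathcal{H})$) denotes the class $[\{\sum_{l\in F_n}T_l^*g_l\}_n]_{\sim_{T^d,\omega}}$. *)

(* Defs.v *)
From HB Require Import structures.
From mathcomp Require Import all_boot all_order all_algebra sesquilinear complex finmap.
From mathcomp Require Import all_classical all_reals all_analysis.
From mathcomp Require summability.

Set Implicit Arguments.
Unset Strict Implicit.
Unset Printing Implicit Defensive.
Import Order.TTheory GRing.Theory Num.Theory.
Import numFieldNormedType.Exports.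
Local Open Scope classical_set_scope.
Local Open Scope ring_scope.
Local Open Scope complex_scope.

(* Complex Hilbert spaces; the inner product is linear in its first argument. *)
HB.mixin Record isHilbert (R : realType) H of CompleteNormedModule R[i] H := {
  inner : {dot H for (@Num.conj R[i])} ;
  innerxx : forall x : H, inner x x = `|x| ^+ 2
}.

#[short(type="hilbertType")]
HB.structure Definition Hilbert (R : realType) :=
  {H of isHilbert R H & CompleteNormedModule R[i] H}.

Definition separable (T : topologicalType) : Prop :=
  exists2 D : set T, countable D & dense D.

(* The library norm takes values in R[i]; hnorm is the same number in R. *)
Definition hnorm (R : realType) (H : hilbertType R) (x : H) : R :=
  complex.Re `|x|.

Section UnconditionalSums.
Variables (R : realType) (I : choiceType) (V : normedModType R[i]).

(* Convergence along the finite subsets of I ordered by inclusion. *)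
Definition unconditional_sum (h : I -> V) (s : V) : Prop :=
  summability.partial_sum h @ summability.totally --> s.

Definition unconditionally_summable (h : I -> V) : Prop :=
  exists s, unconditional_sum h s.

End UnconditionalSums.

Section BoundedOperators.
Variables (R : realType) (H : hilbertType R).

Record bounded_op := BoundedOp {
  bop_fun :> {linear H -> H};
  bop_continuous : continuous bop_fun
}.

HB.instance Definition _ := gen_eqMixin bounded_op.
HB.instance Definition _ := gen_choiceMixin bounded_op.

Lemma bop0_continuous : continuous (\0 : {linear H -> H}).
Proof. by move=> x; exact: cvg_cst. Qed.

Lemma bop1_continuous : continuous (idfun : {linear H -> H}).
Proof. by move=> x; exact: cvg_id. Qed.

Lemma bop_comp_continuous (S S' : bounded_op) :
  continuous (S \o S' : {linear H -> H}).
Proof.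
by move=> x; apply: continuous_comp; exact: bop_continuous.
Qed.

Definition bop0 : bounded_op := BoundedOp bop0_continuous.
Definition bop1 : bounded_op := BoundedOp bop1_continuous.
Definition bop_comp (S S' : bounded_op) : bounded_op :=
  BoundedOp (@bop_comp_continuous S S').

Definition opnorm (S : bounded_op) : R :=
  sup [set hnorm (S x) | x in [set x : H | hnorm x <= 1]].

(* The adjoint exists (Riesz) and is unique, so the default bop0 is never
   taken. *)
Definition adj (S : bounded_op) : bounded_op :=
  xget bop0 [set S' : bounded_op |
    forall x y : H, inner (S x) y = inner x (S' y)].

End BoundedOperators.

Section Sequences.
Variables (R : realType) (H : hilbertType R) (I : choiceType).
Implicit Types (p : \bar R) (w : I -> R) (f g c : I -> H).

Definition linf_norm w f : \bar R :=
  ereal_sup (0%E |` range (fun k => (hnorm (f k) * w k)%:E)).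

(* The value at p = 0 is the norm of the closed subspace l^0_w of l^infty_w;
   negative p are not used. *)
Definition lp_norm p w f : \bar R :=
  match p with
  | r%:E => if r == 0 then linf_norm w f
            else ((\esum_(k in [set: I]) ((hnorm (f k) * w k) `^ r)%:E)
                    `^ (r^-1))%E
  | _ => linf_norm w f
  end.

Definition ell00 : set (I -> H) :=
  [set c | finite_set [set k | c k != 0]].

Definition ell p w : set (I -> H) :=
  if p == 0%E then
    [set f | forall e : R, 0 < e ->
       exists2 c, ell00 c & (linf_norm w (f - c)%R < e%:E)%E]
  else [set f | (lp_norm p w f < +oo)%E].

Definition bounded_on p w (S : (I -> H) -> (I -> H)) : Prop :=
  [/\ forall f, ell p w f -> ell p w (S f),
      forall (a : R[i]) f g, ell p w f -> ell p w g ->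
        S (a *: f + g) = a *: S f + S g &
      exists C : R, forall f, ell p w f ->
        (lp_norm p w (S f) <= C%:E * lp_norm p w f)%E].

Definition ell2 : set (I -> H) := ell 2%:E (cst 1).

Definition ell2_inner f g : R[i]^o :=
  summability.sum (fun k => inner (f k) (g k) : R[i]^o).

End Sequences.

Section Matrices.
Variables (R : realType) (H : hilbertType R) (I : choiceType).

Definition opmatrix := I -> I -> bounded_op H.
Implicit Types A B C : opmatrix.

Definition mxid : opmatrix := fun k l => if k == l then bop1 H else bop0 H.

Definition mxadj A : opmatrix := fun k l => adj (A l k).

(* The entries sum_m A_{k,m} B_{m,l} are read in the strong operator
   topology. *)
Definition is_mxprod A B C : Prop :=
  forall k l (h : H), unconditional_sum (fun m => A k m (B m l h)) (C k l h).

Definition mxact A (f : I -> H) : I -> H :=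
  fun k => summability.sum (fun l => A k l (f l)).

Definition defines_bounded p w A : Prop :=
  (forall f : I -> H, ell p w f ->
     forall k, unconditionally_summable (fun l => A k l (f l))) /\
  bounded_on p w (mxact A).

(* The norms |aone| = 1 and |astar a| = |a|, which some authors include in
   the definition, are not required. *)
Record mx_banach_star_algebra := MxBanachStarAlgebra {
  carrier :> completeNormedModType R[i];
  coefs : carrier -> opmatrix;
  aone : carrier;
  amul : carrier -> carrier -> carrier;
  astar : carrier -> carrier;
  coefs_inj : forall a b,
    (forall k l h, coefs a k l h = coefs b k l h) -> a = b;
  coefs_linear : forall k l (h : H), linear (fun a => coefs a k l h);
  coefs_one : forall k l h, coefs aone k l h = mxid k l h;
  coefs_mul : forall a b, is_mxprod (coefs a) (coefs b) (coefs (amul a b));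
  coefs_star : forall a k l h, coefs (astar a) k l h = mxadj (coefs a) k l h;
  amulA : associative amul;
  amul1l : left_id aone amul;
  amul1r : right_id aone amul;
  amul_linearl : forall b, linear (amul ^~ b);
  amul_linearr : forall a, linear (amul a);
  amul_norm : forall a b, `|amul a b| <= `|a| * `|b|;
  astarK : involutive astar;
  astar_antilinear : forall (x : R[i]) a b,
    astar (x *: a + b) = Num.conj x *: astar a + astar b;
  astarM : forall a b, astar (amul a b) = amul (astar b) (astar a)
}.

Definition in_algebra (AA : mx_banach_star_algebra) (A : opmatrix) : Prop :=
  exists a : AA, forall k l h, coefs a k l h = A k l h.

(* The fields sa_bounded to sa_star say that the action on sequences is a
   unital star-monomorphism into B(l^2). *)
Record spectral_algebra (AA : mx_banach_star_algebra) : Prop := {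
  sa_bounded : forall a : AA, defines_bounded 2%:E (cst 1) (coefs a);
  sa_inj : forall a b : AA,
    (forall f, ell2 f -> mxact (coefs a) f = mxact (coefs b) f) -> a = b;
  sa_one : forall f, ell2 f -> mxact (coefs (aone AA)) f = f;
  sa_linear : forall (x : R[i]) (a b : AA) f, ell2 f ->
    mxact (coefs (x *: a + b)) f = x *: mxact (coefs a) f + mxact (coefs b) f;
  sa_mul : forall (a b : AA) f, ell2 f ->
    mxact (coefs (amul a b)) f = mxact (coefs a) (mxact (coefs b) f);
  sa_star : forall (a : AA) f g, ell2 f -> ell2 g ->
    ell2_inner (mxact (coefs a) f) g =
    ell2_inner f (mxact (coefs (astar a)) g);
  sa_inverse_closed : forall (a : AA) (S : (I -> H) -> (I -> H)),
    bounded_on 2%:E (cst 1) S ->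
    (forall f, ell2 f -> S (mxact (coefs a) f) = f) ->
    (forall f, ell2 f -> mxact (coefs a) (S f) = f) ->
    exists b : AA, forall f, ell2 f -> mxact (coefs b) f = S f;
  sa_solid : forall (a : AA) (B : opmatrix),
    (forall k l, opnorm (B k l) <= opnorm (coefs a k l)) ->
    exists2 b : AA, (forall k l h, coefs b k l h = B k l h) & `|b| <= `|a|
}.

Definition admissible (AA : mx_banach_star_algebra) (p0 : R) (w : I -> R) :
    Prop :=
  forall (a : AA) (p : \bar R), (p0%:E < p)%E \/ p = 1%E ->
    defines_bounded p w (coefs a).

Definition gram (U T : I -> bounded_op H) : opmatrix :=
  fun k l => bop_comp (U k) (adj (T l)).

Definition sim_algebra (AA : mx_banach_star_algebra) (U T : I -> bounded_op H) :
    Prop :=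
  in_algebra AA (gram U T).

End Matrices.

Section GFrames.
Variables (R : realType) (H : hilbertType R) (I : choiceType).
Implicit Types T Td : I -> bounded_op H.

Definition energy T (f : H) : \bar R :=
  \esum_(k in [set: I]) (hnorm (T k f) ^+ 2)%:E.

Definition g_frame T : Prop :=
  exists A B : R, [/\ 0 < A, A <= B &
    forall f : H, (A%:E * (hnorm f ^+ 2)%:E <= energy T f)%E /\
                  (energy T f <= B%:E * (hnorm f ^+ 2)%:E)%E].

Definition g_bessel T : Prop :=
  exists2 B : R, 0 < B &
    forall f : H, (energy T f <= B%:E * (hnorm f ^+ 2)%:E)%E.

Definition dual_g_frame T Td : Prop :=
  [/\ g_bessel Td,
      forall f : H, unconditional_sum (fun k => adj (T k) (Td k f)) f &
      forall f : H, unconditional_sum (fun k => adj (Td k) (T k f)) f].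

Definition analysis T (f : H) : I -> H := fun k => T k f.

(* Only meant for finitely supported c, for which the sum is finite. *)
Definition synthesis T (c : I -> H) : H :=
  \sum_(k \in [set: I]) adj (T k) (c k).

Definition H00 T : set H := synthesis T @` @ell00 R H I.

End GFrames.

Section Coorbits.
Variables (R : realType) (H : hilbertType R) (I : choiceType).
Variables (Td T : I -> bounded_op H) (w : I -> R).
Implicit Types (p : \bar R) (f g : nat -> H) (F G : set (nat -> H)).

(* Both for p < oo and for p = oo, the elements of H^p_w(Td, T) are
   equivalence classes, represented as sets of sequences in H. *)

Definition hnormp p (h : H) : \bar R := lp_norm p w (analysis Td h).

Definition hp_cauchy p f : Prop :=
  (forall n, H00 T (f n)) /\
  forall e : R, 0 < e -> exists N, forall m n, (N <= m)%N -> (N <= n)%N ->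
    (hnormp p (f m - f n)%R < e%:E)%E.

Definition hp_equiv p f g : Prop :=
  hnormp p (f n - g n) @[n --> \oo] --> 0%E.

Definition hp_class p f : set (nat -> H) :=
  [set g | hp_cauchy p g /\ hp_equiv p f g].

Definition Hp p : set (set (nat -> H)) :=
  [set F | exists2 f, hp_cauchy p f & F = hp_class p f].

Definition hp_norm p F : \bar R :=
  get [set r : \bar R |
    forall f, F f -> hnormp p (f n) @[n --> \oo] --> r].

Definition hp_emb p (h : H) : set (nat -> H) := hp_class p (cst h).

(* The difference of two cosets of the space of null sequences. *)
Definition hp_sub F G : set (nat -> H) := [set f - g | f in F & g in G].

(* The extension of Td_k to H^p_w(Td, T): the common limit of Td_k f_n over
   all representatives (f_n). *)
Definition ext_coef F (k : I) : H :=
  get [set c : H | forall f, F f -> Td k (f n) @[n --> \oo] --> c].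

(* Only meant for h with values in H00 T, where hp_emb is the embedding of
   H00 T into its completion. *)
Definition hp_unconditional_sum p (h : I -> H) F : Prop :=
  hp_norm p (hp_sub (hp_emb p (summability.partial_sum h J)) F)
    @[J --> summability.totally] --> 0%E.

Definition hinf_equiv f g : Prop :=
  (forall k, hnorm (Td k (f n - g n)) @[n --> \oo] --> 0) /\
  (ereal_sup (range (fun n => hnormp +oo (f n - g n)%R)) < +oo)%E.

Definition hinf_class f : set (nat -> H) := [set g | hinf_equiv f g].

Definition hinf_bounded f : Prop :=
  (forall k, exists c : H, Td k (f n) @[n --> \oo] --> c) /\
  (ereal_sup (range (fun n => hnormp +oo (f n))) < +oo)%E.

Definition Hinf : set (set (nat -> H)) :=
  [set F | exists2 f, hinf_bounded f & F = hinf_class f].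

Definition nested_exhaustion (J : nat -> {fset I}) : Prop :=
  (forall n, (J n `<=` J n.+1)%fset) /\ forall k, exists n, k \in J n.

Definition sigma_unconditional_sum (h : I -> H) F : Prop :=
  forall J : nat -> {fset I}, nested_exhaustion J ->
  forall f, F f -> forall y : H, H00 Td y ->
  exists L : R[i]^o,
    ((inner (summability.partial_sum h (J n)) y : R[i]^o)
       @[n --> \oo] --> L) /\
    ((inner (f n) y : R[i]^o) @[n --> \oo] --> L).

Definition hinf_sum (h : I -> H) F : Prop :=
  forall J : nat -> {fset I}, nested_exhaustion J ->
  F = hinf_class (fun n => summability.partial_sum h (J n)).

End Coorbits.

Definition weight (R : realType) (d : nat) (w : 'rV[R]_d -> R) : Prop :=
  continuous w /\ forall x, 0 < w x.

(* Main.v *)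
Require Import Defs.
From mathcomp Require Import all_boot all_order all_algebra sesquilinear complex finmap.
From mathcomp Require Import all_classical all_reals all_analysis.
From mathcomp Require summability.
From mathcomp Require Import ring.
Set Implicit Arguments.
Unset Strict Implicit.
Unset Printing Implicit Defensive.
Import Order.TTheory GRing.Theory Num.Theory.
Import numFieldNormedType.Exports.
Local Open Scope classical_set_scope.
Local Open Scope ring_scope.
Local Open Scope complex_scope.

#[local] Existing Instance summability.totally_filter.

(* Write [G] for the cross Gram matrix [Td_k T_l^*] and [C] for the analysis
   operator of [Td], so that [C (sum_(l in J) T_l^* c_l) = G (1_J c)] and, by
   duality, [G (C f) = C f] for [f] in [H].

   For [p < oo], the coefficients [c] of an element of [H^p_w] are the
   l^p_w-limit of sequences [C f_n]; boundedness of [G] gives [G c = c], hence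
   [C (sum_(l in J) T_l^* c_l) - c = - G (c - 1_J c)], and the tails of [c]
   vanish.

   For [p = oo], the tails of a bounded sequence need not vanish.  Instead,
   solidity of the algebra gives [sum_l |G_kl| / w(l) < oo] for each [k], so
   dominated convergence makes [G] continuous for coordinatewise convergence
   of bounded sequences.  This gives again [G c = c], and then [1_J c -> c]
   yields convergence of all coefficients of the partial sums. *)

(** * Norms and bounded operators *)

(** The order of [R[i]] compares only numbers with equal imaginary parts, so a positive [e] has no
    imaginary part. This reduces epsilons in [R[i]] to real ones. *)
Lemma gt0_complexE (R : realType) (e : R[i]) : 0 < e -> e = (complex.Re e)%:C.
Proof. by case: e => a b; rewrite ltcE /= => /andP[/eqP -> _]. Qed.

Section Hnorm.
Variables (R : realType) (H : hilbertType R).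
Implicit Types x y : H.

Lemma hnormE x : `|x| = (hnorm x)%:C.
Proof.
have : 0 <= `|x| by [].
by rewrite /hnorm; case: `|x| => a b; rewrite lecE /= => /andP[/eqP -> _].
Qed.

Lemma hnorm_ge0 x : 0 <= hnorm x.
Proof. by rewrite -(@lecR R) -hnormE; exact: normr_ge0. Qed.

Lemma hnorm0 : hnorm (0 : H) = 0.
Proof. by rewrite /hnorm normr0. Qed.

Lemma hnorm0_eq0 x : hnorm x = 0 -> x = 0.
Proof. by move=> x0; apply/eqP; rewrite -normr_eq0 hnormE x0. Qed.

Lemma hnorm_triangle x y : hnorm (x + y) <= hnorm x + hnorm y.
Proof.
by rewrite -(@lecR R) rmorphD /= -!hnormE ler_normD.
Qed.

Lemma hnorm_opp x : hnorm (- x) = hnorm x.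
Proof. by rewrite /hnorm normrN. Qed.

Lemma hdistC x y : hnorm (x - y) = hnorm (y - x).
Proof. by rewrite -hnorm_opp opprB. Qed.

Lemma hnormZ (a : R) x : hnorm (a%:C *: x) = `|a| * hnorm x.
Proof.
apply: (@complexI R); rewrite -hnormE normrZ rmorphM /= hnormE; congr (_ * _).
by rewrite normc_def /= expr0n addr0 sqrtr_sqr.
Qed.

Lemma hnorm_sum (I : Type) (s : seq I) (f : I -> H) :
  hnorm (\sum_(i <- s) f i) <= \sum_(i <- s) hnorm (f i).
Proof.
elim: s => [|i s IH]; first by rewrite !big_nil hnorm0.
by rewrite !big_cons (le_trans (hnorm_triangle _ _))// lerD2l.
Qed.

Lemma cvg_hnormP (U : Type) (F : set_system U) {FF : Filter F} (f : U -> H) (l : H) :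
  f @ F --> l <-> forall e : R, 0 < e -> \forall t \near F, hnorm (f t - l) < e.
Proof.
split=> [/cvgrPdist_lt cf e e0|cf].
  have := cf e%:C; rewrite ltcR => /(_ e0); apply: filterS => t.
  by rewrite hnormE ltcR hdistC.
apply/cvgrPdist_lt => e e0.
have eE := gt0_complexE e0.
have := cf (complex.Re e); rewrite eE ltcR in e0 => /(_ e0); apply: filterS => t.
by rewrite eE hnormE ltcR hdistC.
Qed.

Lemma cvg_hnorm0P (U : Type) (F : set_system U) {FF : Filter F} (f : U -> H) :
  hnorm (f t) @[t --> F] --> (0 : R) <-> f @ F --> (0 : H).
Proof.
split=> [/cvgr0Pnorm_lt f0|/cvg_hnormP f0].
  apply/cvg_hnormP => e /f0; apply: filterS => t.
  by rewrite subr0 ger0_norm// hnorm_ge0.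
apply/cvgr0Pnorm_lt => e /f0; apply: filterS => t.
by rewrite subr0 ger0_norm// hnorm_ge0.
Qed.

Lemma hnorm_cvg_unique (U : Type) (F : set_system U) {FF : ProperFilter F}
  (f : U -> H) (l l' : H) : f @ F --> l -> f @ F --> l' -> l = l'.
Proof. exact: (@cvg_unique _ (@norm_hausdorff _ H)). Qed.

Lemma hnorm_le_all_eq x y : (forall e : R, 0 < e -> hnorm (x - y) <= e) -> x = y.
Proof.
move=> xy; apply/eqP; rewrite -subr_eq0; apply/eqP/hnorm0_eq0/eqP.
by rewrite eq_le hnorm_ge0 andbT; apply/ler_addgt0Pr => e e0; rewrite add0r xy.
Qed.

Lemma hcauchy_cvg (f : nat -> H) :
  (forall e : R, 0 < e -> exists N, forall m n, (N <= m)%N -> (N <= n)%N ->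
     hnorm (f m - f n) < e) ->
  exists l : H, f @ \oo --> l.
Proof.
move=> cf; suff : cvg (f @ \oo) by move=> /cvg_ex.
apply/cauchy_cvgP; apply/cauchy_ballP => e e0.
have eE := gt0_complexE e0.
have := cf (complex.Re e); rewrite eE ltcR in e0 => /(_ e0)[N cN].
exists (f @` [set n | (N <= n)%N], f @` [set n | (N <= n)%N]) => /=.
  by split; exists N => // n /= Nn; exists n.
case=> _ _ [/= [m Nm <-] [n Nn <-]].
by rewrite -ball_normE /= eE hnormE ltcR; exact: cN.
Qed.

Lemma bop_hnorm_bound (S : bounded_op H) :
  exists2 M : R, 0 <= M & forall x, hnorm (S x) <= M * hnorm x.
Proof.
have bS := continuous_linear_bounded 0 (@bop_continuous _ _ S 0).
have /pinfty_ex_gt0[M M0 SM] := (linear_boundedP S).1 bS.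
have ME := gt0_complexE M0.
exists (complex.Re M) => [|x]; first by move: M0; rewrite ME ltcR => /ltW.
by rewrite -(@lecR R) rmorphM /= -!hnormE -ME; exact: SM.
Qed.

(** A continuous linear map is bounded, so the set defining [opnorm] has an upper bound and [sup] is
    a genuine supremum. *)
Lemma opnorm_has_sup (S : bounded_op H) :
  has_sup [set hnorm (S x) | x in [set x : H | hnorm x <= 1]].
Proof.
split; first by exists (hnorm (S 0)), 0 => //=; rewrite hnorm0.
have [M M0 SM] := bop_hnorm_bound S.
exists M => _ [x /= x1 <-]; rewrite (le_trans (SM x))//.
by rewrite -[leRHS]mulr1 ler_wpM2l.
Qed.

Lemma opnorm_ge0 (S : bounded_op H) : 0 <= opnorm S.
Proof.
apply: le_trans (hnorm_ge0 (S 0)) _; apply: ub_le_sup.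
  by have [] := opnorm_has_sup S.
by exists 0; rewrite //= hnorm0.
Qed.

Lemma hnorm_le_opnorm (S : bounded_op H) x : hnorm (S x) <= opnorm S * hnorm x.
Proof.
have [/hnorm0_eq0->|x0] := eqVneq (hnorm x) 0.
  by rewrite raddf0 hnorm0 mulr0.
have xgt0 : 0 < hnorm x by rewrite lt_neqAle eq_sym x0 hnorm_ge0.
have xE : x = (hnorm x)%:C *: ((hnorm x)^-1%:C *: x).
  by rewrite scalerA -rmorphM /= mulfV// scale1r.
rewrite {1}xE linearZ /= hnormZ ger0_norm ?hnorm_ge0//.
rewrite mulrC ler_wpM2r ?hnorm_ge0//; apply: ub_le_sup.
  by have [] := opnorm_has_sup S.
exists ((hnorm x)^-1%:C *: x) => //=.
by rewrite hnormZ normfV ger0_norm ?hnorm_ge0// mulVf.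
Qed.

End Hnorm.

(** * Weighted sequence quasi-norms *)

Lemma near_fset (U : Type) (F : set_system U) {FF : Filter F} (I : choiceType)
    (J : {fset I}) (P : I -> U -> Prop) :
  (forall k, \forall t \near F, P k t) ->
  \forall t \near F, forall k, k \in J -> P k t.
Proof.
move=> FP; have : \forall t \near F, forall k : J, P (val k) t.
  exact: filter_forall.
by apply: filterS => t Pt k kJ; exact: (Pt [` kJ]%fset).
Qed.

Lemma ler_sum_fset (R : realDomainType) (I : choiceType) (J J' : {fset I})
    (x : I -> R) :
  (forall k, 0 <= x k) -> (J `<=` J')%fset ->
  \sum_(k <- J) x k <= \sum_(k <- J') x k.
Proof.
move=> x0 JJ'.
rewrite (eq_big_seq (fun k => if k \in J then x k else 0)); last by move=> k /= ->.
rewrite (big_fset_incl _ JJ'); last by move=> k _ /negPf ->.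
by apply: ler_sum => k _; case: ifP.
Qed.

Section SequenceNorms.
Variables (R : realType) (H : hilbertType R) (I : choiceType) (w : I -> R).
Hypothesis w_gt0 : forall k, 0 < w k.
Implicit Types (u v : I -> H) (J : {fset I}) (N : (I -> H) -> \bar R).

Definition restrict J u : I -> H := fun k => if k \in J then u k else 0.

Lemma sub_restrictE J u k : (u - restrict J u) k = if k \in J then 0 else u k.
Proof.
rewrite (_ : _ k = u k - restrict J u k)// /restrict.
by case: ifP; rewrite ?subrr ?subr0.
Qed.

(** For [linf_norm] this is membership in the closure of the finitely supported sequences. *)
Definition vanishing_tails N u : Prop :=
  forall e : R, 0 < e -> exists J0, forall J, (J0 `<=` J)%fset ->
    (N (u - restrict J u)%R <= e%:E)%E.

(** Common interface of the sup norm and the norms of finite exponent, so that one argument serves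
    several [p]. The constants [K] admit exponents below 1. Triangle and Fatou properties are
    phrased with real bounds to avoid arithmetic with infinite values, and the Fatou constant need
    not be sharp. *)
Record solid_quasinorm N : Prop := {
  sq_zero : N (fun=> 0) = 0%E;
  sq_mono : forall u v, (forall k, hnorm (u k) <= hnorm (v k)) -> (N u <= N v)%E;
  sq_coord : forall u k, ((hnorm (u k) * w k)%:E <= N u)%E;
  sq_triangle : exists2 K : R, 0 < K & forall u v (a b : R),
    (N u <= a%:E)%E -> (N v <= b%:E)%E -> (N (u + v)%R <= (K * (a + b))%:E)%E;
  sq_fatou : exists2 K : R, 0 < K & forall (u_ : nat -> I -> H) u (a : R), 0 < a ->
    (\forall n \near \oo, (N (u_ n) <= a%:E)%E) ->
    (forall k, u_ n k @[n --> \oo] --> u k) -> (N u <= (K * a)%:E)%E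
}.

Lemma sq_ge0 N u : solid_quasinorm N -> (0 <= N u)%E.
Proof.
by move=> sN; rewrite -(sq_zero sN) (sq_mono sN)// => k; rewrite hnorm0 hnorm_ge0.
Qed.

Lemma sq_opp N u : solid_quasinorm N -> N (- u) = N u.
Proof.
by move=> sN; apply/eqP; rewrite eq_le !(sq_mono sN)// => k;
  rewrite [(- u) k](_ : _ = - u k)// hnorm_opp.
Qed.

Lemma sq_bound_ge0 N u (a : R) : solid_quasinorm N -> (N u <= a%:E)%E -> 0 <= a.
Proof. by move=> sN Na; rewrite -lee_fin (le_trans (sq_ge0 u sN)). Qed.

Let hw_ge0 u k : 0 <= hnorm (u k) * w k.
Proof. by rewrite mulr_ge0 ?hnorm_ge0// ltW. Qed.

Lemma near_small_coords (u_ : nat -> I -> H) u J (e : R) : 0 < e ->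
  (forall k, u_ n k @[n --> \oo] --> u k) ->
  \forall n \near \oo, forall k, k \in J -> hnorm ((u - u_ n) k) * w k < e.
Proof.
move=> e0 uu; apply: near_fset => k; have /cvg_hnormP/(_ (e / w k)) := uu k.
rewrite divr_gt0// => /(_ isT); apply: filterS => n.
by rewrite ltr_pdivlMr//= hdistC.
Qed.

Lemma linf_normP u (a : R) : 0 <= a ->
  (linf_norm w u <= a%:E)%E <-> forall k, hnorm (u k) * w k <= a.
Proof.
move=> a0; split=> [ua k|ua].
  rewrite -lee_fin; apply: le_trans ua; apply: ereal_sup_ubound.
  by right; exists k.
by apply: ge_ereal_sup => _ [->|[k _ <-]]; rewrite lee_fin.
Qed.

Lemma linf_norm_ge0 u : (0 <= linf_norm w u)%E.
Proof. by apply: ereal_sup_ubound; left. Qed.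

Lemma linf_bound_ge0 u (a : R) : (linf_norm w u <= a%:E)%E -> 0 <= a.
Proof. by rewrite -lee_fin; exact/le_trans/linf_norm_ge0. Qed.

Lemma linf_solid_quasinorm : solid_quasinorm (linf_norm w).
Proof.
split.
- apply/eqP; rewrite eq_le linf_norm_ge0 andbT; apply/(linf_normP _ (lexx 0)) => k.
  by rewrite hnorm0 mul0r.
- move=> u v uv; apply: ge_ereal_sup => _ [->|[k _ <-]].
    exact: linf_norm_ge0.
  apply: le_trans (ereal_sup_ubound _); last by right; exists k.
  by rewrite lee_fin ler_wpM2r// ltW.
- by move=> u k; apply: ereal_sup_ubound; right; exists k.
- exists 1 => // u v a b ua vb.
  have [a0 b0] := (linf_bound_ge0 ua, linf_bound_ge0 vb).
  move: ua vb => /(linf_normP _ a0) ua /(linf_normP _ b0) vb.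
  rewrite mul1r; apply/linf_normP; first exact: addr_ge0.
  move=> k; apply: le_trans (lerD (ua k) (vb k)); rewrite -mulrDl.
  by apply: ler_wpM2r; [exact: ltW|exact: hnorm_triangle].
(* The constant 2 comes from [u k = (u - u_ n) k + u_ n k] with both weighted terms at most [a], for
   a suitable [n] depending on [k]. *)
- exists 2 => // u_ u a a0 ua uu.
  apply/linf_normP; first by rewrite mulr_ge0// ltW.
  move=> k; have uk := near_small_coords [fset k]%fset a0 uu.
  have [n [una unk]] := filter_ex (filterI ua uk).
  rewrite mulr_natl mulr2n.
  have -> : u k = (u - u_ n) k + u_ n k by rewrite /= subrK.
  have := lerD (ltW (unk k (fset11 k))) ((linf_normP _ (ltW a0)).1 una k).
  by apply: le_trans; rewrite -mulrDl ler_wpM2r ?hnorm_triangle// ltW.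
Qed.

(** * Quasi-norms of finite exponent, including exponents below 1 *)

Section Lr.
Variable r : R.
Hypothesis r_gt0 : 0 < r.

Let r_neq0 : r != 0. Proof. by rewrite gt_eqF. Qed.
Let r_ge0 : 0 <= r. Proof. exact: ltW. Qed.

Definition lpsum J u : R := \sum_(k <- J) (hnorm (u k) * w k) `^ r.

Lemma powRVK (a : R) : 0 <= a -> (a `^ r^-1) `^ r = a.
Proof. by move=> a0; rewrite -powRrM mulVf// powRr1. Qed.

Lemma powRKV (a : R) : 0 <= a -> (a `^ r) `^ r^-1 = a.
Proof. by move=> a0; rewrite -powRrM mulfV// powRr1. Qed.

Lemma ler_powR2r (x y : R) : 0 <= x -> x <= y -> x `^ r <= y `^ r.
Proof. by move=> x0 xy; rewrite ge0_ler_powR// nnegrE// (le_trans x0). Qed.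

(** The extended sum is the supremum of its finite partial sums, and the powers [r] and [r^-1] are
    monotone and mutually inverse. Later estimates thus concern real finite sums only. *)
Lemma lp_normP u (a : R) : 0 <= a ->
  (lp_norm r%:E w u <= a%:E)%E <-> forall J, lpsum J u <= a `^ r.
Proof.
move=> a0; rewrite /lp_norm (negPf r_neq0).
set E := esum _ _.
have E0 : (0 <= E)%E by apply: esum_ge0 => k _; rewrite lee_fin powR_ge0.
have -> : (E `^ r^-1 <= a%:E)%E <-> (E <= (a `^ r)%:E)%E.
  split=> Ea.
    have := @gt0_ler_poweR _ _ r_ge0 (E `^ r^-1)%E a%:E.
    rewrite -poweRrM mulVf// poweRe1//; apply => //.
      by rewrite in_itv /= poweR_ge0 leey.
    by rewrite in_itv /= lee_fin a0 leey.
  have := @gt0_ler_poweR _ r^-1 _ E (a `^ r)%:E.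
  rewrite poweR_EFin powRKV// invr_ge0; apply => //.
    by rewrite in_itv /= E0 leey.
  by rewrite in_itv /= lee_fin powR_ge0 leey.
split=> [Ea J|Ea].
  rewrite -lee_fin; apply: le_trans Ea; apply: ereal_sup_ubound.
  exists [set` J]; first by split.
  by rewrite fsbig_finite//= set_fsetK sumEFin.
apply: ge_ereal_sup => _ [A [finA _] <-].
by rewrite fsbig_finite//= sumEFin lee_fin; exact: Ea.
Qed.

Lemma lp_norm_ge0 u : (0 <= lp_norm r%:E w u)%E.
Proof. by rewrite /lp_norm (negPf r_neq0) poweR_ge0. Qed.

Lemma lp_bound_ge0 u (a : R) : (lp_norm r%:E w u <= a%:E)%E -> 0 <= a.
Proof. by rewrite -lee_fin; exact/le_trans/lp_norm_ge0. Qed.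

(** Minkowski's inequality fails for [r < 1]; instead [x + y <= 2 * max x y], and the [r]-th power
    of the maximum is at most the sum of the [r]-th powers. The first step costs the factor 2;
    bounding both sums by the [r]-th power of [a + b] costs the factor with exponent [r^-1]. *)
Lemma lpsumD J u v (a b : R) : 0 <= a -> 0 <= b ->
  lpsum J u <= a `^ r -> lpsum J v <= b `^ r ->
  lpsum J (u + v) <= (2 * 2 `^ r^-1 * (a + b)) `^ r.
Proof.
move=> a0 b0 ua vb; have ab0 := addr_ge0 a0 b0.
rewrite !powRM ?mulr_ge0 ?powR_ge0// powRVK// -mulrA.
have le_ab : lpsum J u + lpsum J v <= 2 * (a + b) `^ r.
  rewrite mulr_natl mulr2n lerD// ?(le_trans ua) ?(le_trans vb)// ler_powR2r//.
    by rewrite lerDl.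
  by rewrite lerDr.
apply: le_trans (ler_wpM2l (powR_ge0 _ _) le_ab).
rewrite /lpsum -big_split mulr_sumr; apply: ler_sum => k _ /=.
set x := hnorm (u k) * w k; set y := hnorm (v k) * w k.
have [x0 y0] : 0 <= x /\ 0 <= y by split; exact: hw_ge0.
have xy : hnorm (u k + v k) * w k <= x + y.
  by rewrite -mulrDl ler_wpM2r ?hnorm_triangle// ltW.
apply: le_trans (ler_powR2r _ xy) _; first by rewrite mulr_ge0 ?hnorm_ge0// ltW.
have max0 : 0 <= Num.max x y by rewrite le_max x0.
have : x + y <= 2 * Num.max x y.
  by rewrite mulr_natl mulr2n lerD// le_max lexx ?orbT.
move=> /(ler_powR2r (addr_ge0 x0 y0))/le_trans; apply.
rewrite powRM// ler_wpM2l ?powR_ge0//.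
by case: (leP x y) => _; rewrite ?lerDl ?lerDr powR_ge0.
Qed.

Lemma lpsum_le J u v : (forall k, hnorm (u k) <= hnorm (v k)) ->
  lpsum J u <= lpsum J v.
Proof.
by move=> uv; apply: ler_sum => k _; rewrite ler_powR2r// ler_wpM2r// ltW.
Qed.

Lemma lp_solid_quasinorm : solid_quasinorm (lp_norm r%:E w).
Proof.
split.
- apply/eqP; rewrite eq_le lp_norm_ge0 andbT; apply/(lp_normP _ (lexx 0)) => J.
  by rewrite /lpsum big1 ?powR_ge0// => k _; rewrite hnorm0 mul0r powR0.
- move=> u v uv; have [vfin|] := ltP (lp_norm r%:E w v) +oo%E; last first.
    by rewrite leye_eq => /eqP ->; rewrite leey.
  have vE : lp_norm r%:E w v = (fine (lp_norm r%:E w v))%:E.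
    by rewrite fineK// ge0_fin_numE// lp_norm_ge0.
  have v0 : 0 <= fine (lp_norm r%:E w v) by rewrite fine_ge0// lp_norm_ge0.
  rewrite vE; apply/lp_normP => // J; apply: le_trans (lpsum_le J uv) _.
  by apply: (lp_normP _ v0).1; rewrite -vE.
- move=> u k; have [ufin|] := ltP (lp_norm r%:E w u) +oo%E; last first.
    by rewrite leye_eq => /eqP ->; rewrite leey.
  have uE : lp_norm r%:E w u = (fine (lp_norm r%:E w u))%:E.
    by rewrite fineK// ge0_fin_numE// lp_norm_ge0.
  have u0 : 0 <= fine (lp_norm r%:E w u) by rewrite fine_ge0// lp_norm_ge0.
  have : (lp_norm r%:E w u <= (fine (lp_norm r%:E w u))%:E)%E by rewrite -uE.
  move=> /(lp_normP _ u0)/(_ [fset k]%fset); rewrite uE lee_fin.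
  rewrite /lpsum big_seq_fset1 => uk.
  rewrite -(powRKV (hw_ge0 u k)) -(powRKV u0).
  by apply: ge0_ler_powR; rewrite ?invr_ge0// nnegrE powR_ge0.
- exists (2 * 2 `^ r^-1); first by rewrite mulr_gt0// powR_gt0.
  move=> u v a b ua vb.
  have [a0 b0] := (lp_bound_ge0 ua, lp_bound_ge0 vb).
  apply/lp_normP; first by rewrite !mulr_ge0 ?addr_ge0 ?powR_ge0.
  by move=> J; apply: lpsumD => //; [exact: (lp_normP _ a0).1|exact: (lp_normP _ b0).1].
- exists (2 * 2 `^ r^-1 * 2); first by rewrite !mulr_gt0// powR_gt0.
  move=> u_ u a a0 ua uu.
  apply/lp_normP; first by rewrite !mulr_ge0 ?powR_ge0// ltW.
  (* With [d] so chosen, the coordinates of [u - u_ n] in [J], each at most [d], contribute at most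
     the [r]-th power of [a] in total. The successor keeps [m] positive for empty [J]. *)
  move=> J; pose m : R := (#|` J|).+1%:R.
  have m0 : 0 < m by rewrite ltr0n.
  pose d := a * (m^-1) `^ r^-1.
  have d0 : 0 < d by rewrite mulr_gt0// powR_gt0// invr_gt0.
  have uJ := near_small_coords J d0 uu.
  have [n [una unJ]] := filter_ex (filterI ua uJ).
  rewrite -mulrA (mulr_natl a) mulr2n.
  have -> : u = (u - u_ n) + u_ n by rewrite subrK.
  apply: lpsumD; rewrite ?(ltW a0)//; last exact: (lp_normP _ (ltW a0)).1.
  apply: le_trans (_ : \sum_(k <- J) d `^ r <= _).
    rewrite /lpsum big_seq [leRHS]big_seq; apply: ler_sum => k kJ.
    by apply: ler_powR2r; [exact: hw_ge0|exact/ltW/unJ].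
  rewrite big_const_seq count_predT iter_addr_0 -mulr_natr.
  rewrite /d powRM ?powR_ge0 ?(ltW a0)// powRVK ?invr_ge0 ?(ltW m0)//.
  rewrite -mulrA ler_piMr ?powR_ge0// mulrC ler_pdivrMr// mul1r.
  by rewrite /m ler_nat.
Qed.

Lemma lpsum_restrict J J' u : (J `<=` J')%fset ->
  lpsum J' (restrict J u) = lpsum J u.
Proof.
move=> JJ'; rewrite /lpsum -(big_fset_incl _ JJ').
  by apply: eq_big_seq => k kJ; rewrite /restrict kJ.
by move=> k _ /negPf kJ; rewrite /restrict kJ hnorm0 mul0r powR0.
Qed.

(** Take [J0] whose sum is within the [r]-th power of [e] of the supremum. The tail off [J] and the
    restriction to [J] have disjoint supports, so their sums together stay below the sum over the
    union of [J] and [J'], hence below the supremum. *)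
Lemma lp_vanishing_tails u : (lp_norm r%:E w u < +oo)%E ->
  vanishing_tails (lp_norm r%:E w) u.
Proof.
move=> ufin e e0.
have uE : lp_norm r%:E w u = (fine (lp_norm r%:E w u))%:E.
  by rewrite fineK// ge0_fin_numE// lp_norm_ge0.
have u0 : 0 <= fine (lp_norm r%:E w u) by rewrite fine_ge0// lp_norm_ge0.
have uS : forall J, lpsum J u <= fine (lp_norm r%:E w u) `^ r.
  by apply/lp_normP => //; rewrite -uE.
have supS : has_sup (range (lpsum^~ u)).
  split; first by exists (lpsum fset0 u), fset0.
  by exists (fine (lp_norm r%:E w u) `^ r) => _ [J _ <-].
have er0 : 0 < e `^ r by rewrite powR_gt0.
have [_ [J0 _ <-] J0S] := sup_adherent er0 supS.
exists J0 => J J0J; apply/lp_normP; first exact: ltW.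
move=> J'; rewrite -(lerD2r (lpsum J u)).
apply: le_trans (_ : sup (range (lpsum^~ u)) <= _); last first.
  rewrite addrC -lerBlDr (le_trans (ltW J0S))//.
  by apply: ler_sum_fset => // k; rewrite powR_ge0.
apply: le_trans (_ : lpsum (J `|` J')%fset u <= _); last first.
  by apply: ub_le_sup; [have [] := supS|exists (J `|` J')%fset].
rewrite -(lpsum_restrict u (fsubsetUl J J')).
apply: le_trans (_ : lpsum (J `|` J')%fset (u - restrict J u) +
  lpsum (J `|` J')%fset (restrict J u) <= _).
  by rewrite lerD2r; apply: ler_sum_fset (fsubsetUr _ _) => k; rewrite powR_ge0.
rewrite /lpsum -big_split; apply: ler_sum => k _ /=.
rewrite sub_restrictE /restrict.
by case: ifP => _; rewrite hnorm0 mul0r powR0// ?addr0 ?add0r.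
Qed.

Lemma lp_restrict_lty J u : (lp_norm r%:E w (restrict J u) < +oo)%E.
Proof.
have S0 : 0 <= lpsum J u by apply: sumr_ge0 => k _; rewrite powR_ge0.
apply: le_lt_trans (ltry (lpsum J u `^ r^-1)); apply/lp_normP; first exact: powR_ge0.
move=> J'; rewrite powRVK//.
rewrite -(lpsum_restrict u (fsubsetUl J J')).
by apply: ler_sum_fset (fsubsetUr _ _) => k; rewrite powR_ge0.
Qed.

(** For [p = 0] this transfers finiteness and vanishing tails from l^1 to the sup norm. *)
Lemma linf_le_lp u : (linf_norm w u <= lp_norm r%:E w u)%E.
Proof.
apply: ge_ereal_sup => _ [->|[k _ <-]]; first exact: lp_norm_ge0.
exact: sq_coord lp_solid_quasinorm _ _.
Qed.

End Lr.

End SequenceNorms.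

(** * Unconditional sums and the Gram matrix *)

Section UnconditionalSumFacts.
Variables (R : realType) (H : hilbertType R) (I : choiceType).
Implicit Types (h : I -> H) (J : {fset I}).

Lemma partial_sumE h J : summability.partial_sum h J = \sum_(i <- J) h i.
Proof. by rewrite /summability.partial_sum big_seq_fsetE. Qed.

Lemma unconditional_sumP h (s : H) : unconditional_sum h s <->
  forall e : R, 0 < e -> exists J0, forall J, (J0 `<=` J)%fset ->
    hnorm (summability.partial_sum h J - s) < e.
Proof.
rewrite /unconditional_sum; split=> [/cvg_hnormP hs e /hs[J0 _ J0P]|hs].
  by exists J0.
by apply/cvg_hnormP => e /hs[J0 J0P]; exists J0.
Qed.

Lemma unconditional_sum_unique h (s : H) :
  unconditional_sum h s -> summability.sum h = s.
Proof. by move=> hs; apply: cvg_lim hs; exact: norm_hausdorff. Qed.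

Lemma unconditional_sum_bop (S : bounded_op H) h (s : H) :
  unconditional_sum h s -> unconditional_sum (fun k => S (h k)) (S s).
Proof.
move=> hs; rewrite /unconditional_sum.
have -> : summability.partial_sum (fun k => S (h k)) =
    (fun J => S (summability.partial_sum h J)).
  by apply/funext => J; rewrite !partial_sumE linear_sum.
apply: cvg_comp hs _; exact: bop_continuous.
Qed.

Lemma unconditional_sum_fset h J : (forall k, k \notin J -> h k = 0) ->
  unconditional_sum h (\sum_(k <- J) h k).
Proof.
move=> h0; apply/unconditional_sumP => e e0; exists J => J' JJ'.
rewrite partial_sumE (big_fset_incl _ JJ'); last by move=> k _ /h0.
by rewrite subrr hnorm0.
Qed.

Lemma mxact_restrict (A : opmatrix H I) J (u : I -> H) k :
  mxact A (restrict J u) k = \sum_(l <- J) A k l (u l).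
Proof.
rewrite /mxact (@unconditional_sum_unique _ (\sum_(l <- J) A k l (restrict J u l))).
  by apply: eq_big_seq => l lJ; rewrite /restrict lJ.
by apply: unconditional_sum_fset => l /negPf lJ; rewrite /restrict lJ raddf0.
Qed.

End UnconditionalSumFacts.

(** * The cross Gram matrix on finite and full coefficient sequences *)

Section Gram.
Variables (R : realType) (H : hilbertType R) (I : choiceType).
Variables T Td : I -> bounded_op H.
Implicit Types (u : I -> H) (J : {fset I}).

Definition finite_synthesis u J : H :=
  summability.partial_sum (fun k => adj (T k) (u k)) J.

Lemma gram_finite_synthesis u J :
  mxact (gram Td T) (restrict J u) = analysis Td (finite_synthesis u J).
Proof.
apply/funext => k; rewrite mxact_restrict /analysis /finite_synthesis.
by rewrite partial_sumE linear_sum.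
Qed.

(** The continuous operator [Td k] may be applied termwise to the expansion of [f]. *)
Lemma gram_analysis (f : H) :
  unconditional_sum (fun k => adj (T k) (Td k f)) f ->
  mxact (gram Td T) (analysis Td f) = analysis Td f.
Proof.
by move=> Tf; apply/funext => k; apply: unconditional_sum_unique;
  exact: unconditional_sum_bop.
Qed.

(** Trades a finitely supported sequence for an arbitrary one summed over a finite set, which is the
    form taken by partial sums. *)
Lemma H00P (x : H) : H00 T x <-> exists u J, x = finite_synthesis u J.
Proof.
split=> [[c /= cfin <-]|[u [J ->]]].
  exists c, (fset_set [set k | c k != 0]); rewrite /finite_synthesis partial_sumE.
  rewrite -fsbig_finite//= /synthesis; apply/esym/fsbig_widen => // k [_ /= /negP].
  by rewrite negbK => /eqP ->; rewrite raddf0.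
exists (restrict J u).
  apply: sub_finite_set (finite_fset J) => k /=; rewrite /restrict.
  by case: ifP => //; rewrite eqxx.
rewrite /synthesis /finite_synthesis partial_sumE.
rewrite -(fsbig_widen [set` J] setT)//; last first.
  by move=> k [_ /= /negP/negPf kJ]; rewrite /restrict kJ raddf0.
rewrite fsbig_finite//= set_fsetK; apply: eq_big_seq => k kJ.
by rewrite /restrict kJ.
Qed.

Lemma analysisB (f g : H) : analysis Td (f - g) = analysis Td f - analysis Td g.
Proof. by apply/funext => k; exact: linearB. Qed.

End Gram.

(** Nonstrict real bounds force the values to be finite near the limit; halving [e] then recovers
    the strict inequality that neighbourhoods of 0 demand. *)
Lemma cvg_ereal0P (R : realType) (U : Type) (F : set_system U) {FF : Filter F}
    (f : U -> \bar R) : (forall t, (0 <= f t)%E) ->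
  f @ F --> 0%E <-> forall e : R, 0 < e -> \forall t \near F, (f t <= e%:E)%E.
Proof.
move=> f0; split=> [cf e e0|cf].
  have e_nbhs : \forall x \near (0%E : \bar R), (x < e%:E)%E.
    exists e => //= x /=; rewrite sub0r normrN lte_fin.
    exact: le_lt_trans (ler_norm _).
  have fe : \forall t \near F, (f t < e%:E)%E := cf _ e_nbhs.
  by apply: filterS fe => t /ltW.
move=> A /= [e /= e0 eA].
have := cf (e / 2); rewrite divr_gt0// => /(_ isT); apply: filterS => t fe.
have ft : f t = (fine (f t))%:E.
  by rewrite fineK// ge0_fin_numE// (le_lt_trans fe) ?ltry.
rewrite /= ft; apply: eA; rewrite /= sub0r normrN.
move: fe (f0 t); rewrite ft !lee_fin => fe ft0.
by rewrite ger0_norm// (le_lt_trans fe)// ltr_pdivrMr// ltr_pMr// ltr1n.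
Qed.

(** * Finite exponents and p = 0 *)

Section FiniteExponent.
Variables (R : realType) (H : hilbertType R) (I : choiceType) (w : I -> R).
Hypothesis w_gt0 : forall k, 0 < w k.
Variables T Td : I -> bounded_op H.
Variable p : \bar R.
Let N : (I -> H) -> \bar R := lp_norm p w.
Let G := mxact (gram Td T).
Hypothesis N_solid : solid_quasinorm w N.
Variable C : R.
Hypothesis G_bound : forall (u : I -> H) (a : R),
  (N u <= a%:E)%E -> (N (G u) <= (C * a)%:E)%E.
Hypothesis G_sub : forall u v : I -> H,
  (N u < +oo)%E -> (N v < +oo)%E -> G (u - v) = G u - G v.
Hypothesis N_restrict : forall J (u : I -> H), (N (restrict J u) < +oo)%E.
(** For a real exponent this follows from finiteness of the norm; for [p = 0] a finite sup norm is
    not enough, and boundedness of the Gram matrix on l^1 supplies it. *)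
Hypothesis G_restrict_tails : forall J (u : I -> H),
  vanishing_tails N (G (restrict J u)).
Hypothesis T_dual : forall f : H,
  unconditional_sum (fun k => adj (T k) (Td k f)) f.
Implicit Types (u v : I -> H) (f g : nat -> H).

Lemma sq_fin u (a : R) : (N u <= a%:E)%E -> (N u < +oo)%E.
Proof. by move=> /le_lt_trans; apply; exact: ltry. Qed.

Lemma sq_finE u : (N u < +oo)%E -> N u = (fine (N u))%:E.
Proof. by move=> uoo; rewrite fineK// ge0_fin_numE// (sq_ge0 u N_solid). Qed.

Lemma H00_fin x : H00 T x ->
  (N (analysis Td x) < +oo)%E /\ vanishing_tails N (analysis Td x).
Proof.
move=> /H00P[u [J ->]]; rewrite -gram_finite_synthesis; split; last first.
  exact: G_restrict_tails.
apply: sq_fin (G_bound (a := fine (N (restrict J u))) _).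
by rewrite -sq_finE.
Qed.

Lemma coord_small u k (e : R) : (N u <= (e * w k)%:E)%E -> hnorm (u k) <= e.
Proof.
move=> /(le_trans (sq_coord N_solid u k)); rewrite lee_fin.
by rewrite ler_pM2r.
Qed.

Lemma hp_cauchy_coords f : hp_cauchy Td T w p f ->
  exists c : I -> H, forall k, Td k (f n) @[n --> \oo] --> c k.
Proof.
move=> [_ cf].
suff /choice[c fc] : forall k, exists l : H, Td k (f n) @[n --> \oo] --> l by exists c.
move=> k; apply: hcauchy_cvg => e e0.
have e2 : 0 < e / 2 * w k by rewrite mulr_gt0 ?divr_gt0.
have [M cM] := cf _ e2; exists M => m n Mm Mn.
have /ltW/(@coord_small _ k) := cM m n Mm Mn; rewrite /analysis linearB.
by move=> /le_lt_trans; apply; rewrite ltr_pdivrMr// ltr_pMr// ltr1n.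
Qed.

(** Fix [n] and let [m] tend to infinity in the Cauchy estimate for [f m - f n]: the coordinates
    converge, and the Fatou property passes the bound to the limit. *)
Lemma hp_cauchy_cvg f (c : I -> H) : hp_cauchy Td T w p f ->
  (forall k, Td k (f n) @[n --> \oo] --> c k) ->
  forall e : R, 0 < e -> \forall n \near \oo, (N (c - analysis Td (f n))%R <= e%:E)%E.
Proof.
move=> [_ cf] fc e e0; have [K K0 fatou] := sq_fatou N_solid.
have [M cM] := cf _ (divr_gt0 e0 K0); exists M => // n /= Mn.
have := fatou (fun m => analysis Td (f m - f n)) (c - analysis Td (f n)) _
  (divr_gt0 e0 K0).
rewrite [K * _]mulrC divfK ?gt_eqF//; apply.
  by exists M => // m /= Mm; exact/ltW/cM.
move=> k; rewrite [(c - _) k](_ : _ = c k - Td k (f n))//.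
under eq_fun do rewrite /analysis linearB.
by apply: cvgB => //; exact: cvg_cst.
Qed.

Lemma hp_equiv_cvg f g (c : I -> H) : hp_equiv Td w p f g ->
  (forall e : R, 0 < e ->
     \forall n \near \oo, (N (c - analysis Td (f n))%R <= e%:E)%E) ->
  forall e : R, 0 < e -> \forall n \near \oo, (N (c - analysis Td (g n))%R <= e%:E)%E.
Proof.
move=> /cvg_ereal0P fg fc e e0; have [K K0 tri] := sq_triangle N_solid.
have d0 : 0 < e / K / 2 by rewrite !divr_gt0.
have {}fg := fg (fun n => sq_ge0 _ N_solid) _ d0.
have {}fc := fc _ d0.
apply: filterS2 fg fc => n fg fc.
have -> : c - analysis Td (g n) = analysis Td (f n - g n) + (c - analysis Td (f n)).
  by rewrite analysisB [RHS]addrC addrA subrK.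
by apply: le_trans (tri _ _ _ _ fg fc) _; rewrite -splitr [K * _]mulrC divfK ?gt_eqF.
Qed.

Lemma near_coords f (c : I -> H) :
  (forall e : R, 0 < e ->
     \forall n \near \oo, (N (c - analysis Td (f n))%R <= e%:E)%E) ->
  forall k, Td k (f n) @[n --> \oo] --> c k.
Proof.
move=> fc k; apply/cvg_hnormP => e e0.
have := fc (e / 2 * w k); rewrite mulr_gt0 ?divr_gt0// => /(_ isT).
apply: filterS => n /(@coord_small _ k); rewrite hdistC => /le_lt_trans; apply.
by rewrite ltr_pdivrMr// ltr_pMr// ltr1n.
Qed.

(** * The limit of the coefficient sequences: finiteness, tails, invariance under the Gram matrix *)

Section Limit.
Variables (f : nat -> H) (c : I -> H).
Hypothesis f_H00 : forall n, H00 T (f n).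
Hypothesis fc : forall e : R, 0 < e ->
  \forall n \near \oo, (N (c - analysis Td (f n))%R <= e%:E)%E.

Lemma limit_fin : (N c < +oo)%E.
Proof.
have [K K0 tri] := sq_triangle N_solid.
have [n fn] := filter_ex (fc ltr01).
rewrite -(subrK (analysis Td (f n)) c).
apply: sq_fin (tri _ _ _ (fine (N (analysis Td (f n)))) fn _).
by rewrite -sq_finE//; exact: (H00_fin (f_H00 n)).1.
Qed.

(** Split [c] into the coefficients of some [f n], whose tails vanish, and a small remainder, whose
    tails are small by solidity. *)
Lemma limit_tails : vanishing_tails N c.
Proof.
move=> e e0; have [K K0 tri] := sq_triangle N_solid.
have d0 : 0 < e / K / 2 by rewrite !divr_gt0.
have [n fn] := filter_ex (fc d0).
have [J0 fJ] := (H00_fin (f_H00 n)).2 _ d0.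
exists J0 => J J0J; pose u := c - analysis Td (f n).
have -> : c - restrict J c =
    (u - restrict J u) + (analysis Td (f n) - restrict J (analysis Td (f n))).
  apply/funext => k; rewrite [RHS](_ : _ = (u - restrict J u) k +
    (analysis Td (f n) - restrict J (analysis Td (f n))) k)//.
  rewrite !sub_restrictE; case: ifP => _; rewrite ?addr0//.
  by rewrite [u k](_ : _ = c k - analysis Td (f n) k)// subrK.
have uJ : (N (u - restrict J u)%R <= (e / K / 2)%:E)%E.
  apply: le_trans fn; apply: (sq_mono N_solid) => k; rewrite sub_restrictE.
  by case: ifP => // _; rewrite hnorm0 hnorm_ge0.
apply: le_trans (tri _ _ _ _ uJ (fJ _ J0J)) _.
by rewrite -splitr [K * _]mulrC divfK ?gt_eqF.
Qed.

Lemma G_bound_gt0 : exists2 C' : R, 0 < C' & forall u (a : R),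
  (N u <= a%:E)%E -> (N (G u) <= (C' * a)%:E)%E.
Proof.
exists (`|C| + 1); first by rewrite ltr_wpDl.
move=> u a ua; apply: le_trans (G_bound ua) _; rewrite lee_fin.
rewrite ler_wpM2r ?(sq_bound_ge0 N_solid ua)//.
by rewrite (le_trans (ler_norm C))// lerDl.
Qed.

Lemma limit_fixed : G c = c.
Proof.
have [K K0 tri] := sq_triangle N_solid.
have [C' C'0 GC] := G_bound_gt0.
apply/funext => k; apply: hnorm_le_all_eq => e e0.
(* With this accuracy the two errors [C' * d] and [d] combine, after the factor [K], to exactly
   [e * w k], which bounds coordinate [k] by [e]. *)
have d0 : 0 < e * w k / (K * (C' + 1)) by rewrite divr_gt0 ?mulr_gt0 ?addr_gt0.
have [n fn] := filter_ex (fc d0).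
have fnf := (H00_fin (f_H00 n)).1.
apply: (@coord_small (G c - c)).
have -> : G c - c = G (c - analysis Td (f n)) + (analysis Td (f n) - c).
  by rewrite (G_sub limit_fin fnf) [G (analysis _ _)]gram_analysis// addrA subrK.
have fn' : (N (analysis Td (f n) - c)%R <= (e * w k / (K * (C' + 1)))%:E)%E.
  by rewrite -(sq_opp _ N_solid) opprB.
apply: le_trans (tri _ _ _ _ (GC _ _ fn) fn') _.
rewrite lee_fin -[X in _ + X]mul1r -mulrDl mulrA [leLHS]mulrC divfK//.
by rewrite gt_eqF// mulr_gt0// addr_gt0.
Qed.

Lemma limit_expansion (e : R) : 0 < e -> exists J0, forall J, (J0 `<=` J)%fset ->
  (N (analysis Td (finite_synthesis T c J) - c)%R <= e%:E)%E.
Proof.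
move=> e0; have [C' C'0 GC] := G_bound_gt0.
have [J0 cJ] := limit_tails (divr_gt0 e0 C'0).
exists J0 => J /cJ/GC; rewrite mulrC divfK ?gt_eqF//.
rewrite (G_sub limit_fin (N_restrict J c)) limit_fixed -(sq_opp _ N_solid) opprB.
by rewrite [G _]gram_finite_synthesis.
Qed.

End Limit.

(* In both lemmas, if no limit of norms exists then [hp_norm] is the default
   value [0] of [get] and the bound is trivial. *)
Lemma hp_norm_ge0 (S : set (nat -> H)) g : S g -> (0 <= hp_norm Td w p S)%E.
Proof.
move=> Sg; rewrite /hp_norm; set P := (X in get X).
have [Pex|nPex] := pselect (exists r, P r).
  have /(_ g Sg)/cvge_to_ge := getPex Pex; apply.
  by apply: nearW => n; exact: sq_ge0 N_solid.
by rewrite (getPN (P := P))// => r Pr; apply: nPex; exists r.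
Qed.

Lemma hp_norm_le (S : set (nat -> H)) g (e : R) : 0 <= e -> S g ->
  (\forall n \near \oo, (N (analysis Td (g n)) <= e%:E)%E) ->
  (hp_norm Td w p S <= e%:E)%E.
Proof.
move=> e0 Sg ge; rewrite /hp_norm; set P := (X in get X).
have [Pex|nPex] := pselect (exists r, P r).
  by have /(_ g Sg)/cvge_to_le := getPex Pex; apply.
by rewrite (getPN (P := P))// => r Pr; apply: nPex; exists r.
Qed.

Lemma Hp_expansion F : Hp Td T w p F ->
  hp_unconditional_sum Td T w p (fun k => adj (T k) (ext_coef Td F k)) F.
Proof.
move=> [f cf FE]; have [c fc] := hp_cauchy_coords cf.
have Nfc := hp_cauchy_cvg cf fc.
have FP g : F g -> forall e : R, 0 < e ->
    \forall n \near \oo, (N (c - analysis Td (g n))%R <= e%:E)%E.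
  by rewrite FE => -[_ fg]; exact: hp_equiv_cvg fg Nfc.
have N00 : N (fun=> 0) = 0%E := sq_zero N_solid.
have analysis0 : analysis Td (0 : H) = (fun=> 0).
  by apply/funext => k; rewrite /analysis raddf0.
have hp_refl g : hp_equiv Td w p g g.
  rewrite /hp_equiv; under eq_fun do rewrite subrr /hnormp analysis0.
  by rewrite -/N N00; exact: cvg_cst.
have Ff : F f by rewrite FE.
(* All representatives of [F] share the coefficient limits [c], so [get] has exactly one
   candidate. *)
have -> : ext_coef Td F = c.
  apply/funext => k; apply: get_unique => /=.
    by move=> g Fg; exact: near_coords (FP g Fg) k.
  by move=> d /(_ f Ff) fd; exact: hnorm_cvg_unique fd (fc k).
have hJ_emb J : hp_emb Td T w p (finite_synthesis T c J) (cst (finite_synthesis T c J)).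
  split; last exact: hp_refl.
  split=> [n|e e0]; first by apply/H00P; exists c, J.
  by exists 0%N => m n _ _; rewrite subrr /hnormp analysis0 -/N N00.
(* An explicit representative of the difference, on which its norm can be estimated. *)
have sub_mem J : hp_sub (hp_emb Td T w p (finite_synthesis T c J)) F
    (cst (finite_synthesis T c J) - f).
  by exists (cst (finite_synthesis T c J)); [exact: hJ_emb|exists f].
apply/cvg_ereal0P => [J|e e0]; first exact: hp_norm_ge0 (sub_mem J).
have [K K0 tri] := sq_triangle N_solid.
have d0 : 0 < e / K / 2 by rewrite !divr_gt0.
have [J0 cJ] := limit_expansion cf.1 Nfc d0.
exists J0 => // J /= J0J; apply: hp_norm_le (ltW e0) (sub_mem J) _.
apply: filterS (Nfc _ d0) => n fn.
have -> : analysis Td ((cst (finite_synthesis T c J) - f) n) =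
    (analysis Td (finite_synthesis T c J) - c) + (c - analysis Td (f n)).
  by rewrite [_ n](_ : _ = finite_synthesis T c J - f n)// analysisB addrA subrK.
apply: le_trans (tri _ _ _ _ (cJ J J0J) fn) _.
by rewrite -splitr [K * _]mulrC divfK ?gt_eqF.
Qed.

End FiniteExponent.

(** * The exponent p = oo *)

Section InnerProduct.
Variables (R : realType) (H : hilbertType R).
Implicit Types x y : H.

(** Cauchy-Schwarz, by Pythagoras for [x = z + a *: y] with [z] orthogonal to [y]. *)
Lemma inner_bound x y : `|inner x y| <= `|x| * `|y|.
Proof.
have [->|y0] := eqVneq y 0.
  by rewrite linear0r normr0 mulr_ge0.
have yy0 : 0 < inner y y by rewrite dnorm_gt0.
pose a := inner x y / inner y y; pose z := x - a *: y.
have zy : inner z y = 0.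
  by rewrite linearBl /= linearZl_LR /= divfK ?subrr// gt_eqF.
have axx : `|a| ^+ 2 * inner y y <= inner x x.
  have -> : x = z + a *: y by rewrite subrK.
  have -> : inner (z + a *: y) (z + a *: y) = inner z z + inner (a *: y) (a *: y).
    by apply: hnormDd; rewrite linearZr_LR /= zy mulr0.
  have -> : inner (a *: y) (a *: y) = `|a| ^+ 2 * inner y y by exact: dnormZ.
  by rewrite lerDr; exact: dnorm_ge0.
rewrite -ler_sqr ?nnegrE ?mulr_ge0// exprMn -!innerxx.
have -> : inner x y = a * inner y y by rewrite divfK// gt_eqF.
rewrite normrM exprMn (ger0_norm (ltW yy0)) expr2 mulrA.
by rewrite ler_wpM2r// ltW.
Qed.

Lemma inner_cvg (x_ : nat -> H) x y : x_ n @[n --> \oo] --> x ->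
  (inner (x_ n) y : R[i]^o) @[n --> \oo] --> (inner x y : R[i]^o).
Proof.
move=> /cvgrPdist_lt xx; apply/cvgrPdist_lt => e e0.
have d0 : 0 < e / (`|y| + 1) by rewrite divr_gt0// ltr_wpDl.
apply: filterS (xx _ d0) => n xn; rewrite -linearBl /=.
apply: le_lt_trans (inner_bound _ _) _.
move: xn; rewrite ltr_pdivlMr ?ltr_wpDl//; apply: le_lt_trans.
by rewrite ler_wpM2l// lerDl.
Qed.

(* Riesz' theorem rules out the case where [S] has no adjoint and [adj S] is
   the default [0]; the statement also holds there, with limit [0]. *)
Lemma inner_adj_cvg (S : bounded_op H) (c d : H) : exists L : R[i]^o,
  forall x_ : nat -> H, S (x_ n) @[n --> \oo] --> c ->
    (inner (x_ n) (adj S d) : R[i]^o) @[n --> \oo] --> L.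
Proof.
rewrite /adj; case: xgetP => [S' _ SS'|_].
  exists (inner c d) => x_ /(@inner_cvg _ _ d).
  by under eq_fun do rewrite SS'.
exists 0 => x_ _; under eq_fun do rewrite linear0r.
exact: cvg_cst.
Qed.

End InnerProduct.

Lemma ereal_sup_range_lty (R : realType) (a : nat -> \bar R) :
  (forall n, (0 <= a n)%E) ->
  (ereal_sup (range a) < +oo)%E <-> exists M : R, forall n, (a n <= M%:E)%E.
Proof.
move=> a0; split=> [aoo|[M aM]]; last first.
  by apply: le_lt_trans (ltry M); apply: ge_ereal_sup => _ [n _ <-].
exists (fine (ereal_sup (range a))) => n; rewrite fineK.
  by apply: ereal_sup_ubound; exists n.
rewrite ge0_fin_numE//; apply: le_trans (a0 0%N) _.
by apply: ereal_sup_ubound; exists 0%N.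
Qed.

Section InfiniteExponent.
Variables (R : realType) (H : hilbertType R) (I : choiceType) (w : I -> R).
Hypothesis w_gt0 : forall k, 0 < w k.
Variables T Td : I -> bounded_op H.
Let N : (I -> H) -> \bar R := linf_norm w.
Let G := mxact (gram Td T).
Variable C : R.
Hypothesis G_bound : forall (u : I -> H) (a : R),
  (N u <= a%:E)%E -> (N (G u) <= (C * a)%:E)%E.
Hypothesis G_summable : forall u k, (N u < +oo)%E ->
  unconditionally_summable (fun l => gram Td T k l (u l)).
(** The set [J0] depends on [k] and [e] but not on [u]; this uniformity on bounded sets plays the
    role of a dominating summable row. *)
Hypothesis G_dominated : forall k (e : R), 0 < e -> exists J0 : {fset I},
  forall (u : I -> H) (a : R) J, (N u <= a%:E)%E -> (J0 `<=` J)%fset ->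
  hnorm (\sum_(l <- J) gram Td T k l (u l) - \sum_(l <- J0) gram Td T k l (u l))
    <= e * a.
Hypothesis T_dual : forall f : H,
  unconditional_sum (fun k => adj (T k) (Td k f)) f.

Let N_solid : solid_quasinorm w N := linf_solid_quasinorm H w_gt0.

Lemma G_truncation k (e : R) : 0 < e -> exists J0 : {fset I},
  forall (u : I -> H) (a : R), (N u <= a%:E)%E ->
  hnorm (G u k - \sum_(l <- J0) gram Td T k l (u l)) <= e * a.
Proof.
move=> /(G_dominated k)[J0 GJ0]; exists J0 => u a ua.
apply/ler_addgt0Pr => d d0.
have [s us] := G_summable k (le_lt_trans ua (ltry a)).
rewrite /G /mxact (unconditional_sum_unique us).
have [J1 sJ1] := (unconditional_sumP _ _).1 us d d0.
have /ltW sJ := sJ1 (J0 `|` J1)%fset (fsubsetUr _ _).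
rewrite partial_sumE hdistC in sJ.
have GJ := GJ0 u a (J0 `|` J1)%fset ua (fsubsetUl _ _).
rewrite [e * a + d]addrC; apply: le_trans (lerD sJ GJ).
by apply: le_trans (hnorm_triangle _ _); rewrite addrA subrK.
Qed.

(** Dominated convergence: one finite set truncates the rows for all [u_ n] and for [u] with small
    error, and the truncated finite sums converge by continuity of the entries. *)
Lemma G_cvg (u_ : nat -> I -> H) u (a : R) k :
  (forall n, (N (u_ n) <= a%:E)%E) -> (N u <= a%:E)%E ->
  (forall l, u_ n l @[n --> \oo] --> u l) -> G (u_ n) k @[n --> \oo] --> G u k.
Proof.
move=> una ua uu; have a0 := sq_bound_ge0 N_solid ua.
apply/cvg_hnormP => e e0.
(* Dividing by [a + 1] instead of [a] allows [a = 0]; each truncation error is then at most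
   [e / 3]. *)
have d0 : 0 < e / 3 / (a + 1) by rewrite !divr_gt0// ltr_wpDl.
have [J0 GJ0] := G_truncation k d0.
have da : e / 3 / (a + 1) * a <= e / 3.
  by rewrite mulrAC ler_pdivrMr ?ltr_wpDl// ler_wpM2l ?lerDl// divr_ge0// ltW.
have : \sum_(l <- J0) gram Td T k l (u_ n l) @[n --> \oo] -->
    \sum_(l <- J0) gram Td T k l (u l).
  apply: cvg_big => [|l _]; first exact: add_continuous.
  apply: continuous_cvg => //; exact: bop_continuous.
move=> /cvg_hnormP/(_ (e / 3)); rewrite divr_gt0// => /(_ isT).
apply: filterS => n sn.
set x := \sum_(l <- J0) _ in sn; set y := \sum_(l <- J0) _ in sn.
have -> : G (u_ n) k - G u k = (G (u_ n) k - x) + (x - y) + (y - G u k).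
  by rewrite !addrA !subrK.
have h1 := le_trans (GJ0 _ _ (una n)) da.
have h2 := le_trans (GJ0 _ _ ua) da; rewrite hdistC in h2.
have -> : e = e / 3 + e / 3 + e / 3 by field.
apply: le_lt_trans (hnorm_triangle _ _) _; rewrite ltr_leD//.
by apply: le_lt_trans (hnorm_triangle _ _) _; rewrite ler_ltD.
Qed.

(** * Equivalence of bounded sequences is an equivalence relation *)

Lemma hnormp_ge0 (x : H) : (0 <= hnormp Td w +oo x)%E.
Proof. exact: linf_norm_ge0. Qed.

Lemma hinf_equiv_refl f : hinf_equiv Td w f f.
Proof.
split=> [k|]; first by under eq_fun do rewrite subrr raddf0 hnorm0; exact: cvg_cst.
apply/(ereal_sup_range_lty (fun=> hnormp_ge0 _)); exists 0 => n.
apply: le_trans (_ : (N (fun=> 0%R) <= _)%E); last by rewrite (sq_zero N_solid).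
by apply: (sq_mono N_solid) => k; rewrite /analysis subrr raddf0.
Qed.

Lemma hinf_equiv_sym f g : hinf_equiv Td w f g -> hinf_equiv Td w g f.
Proof.
move=> [fg /(ereal_sup_range_lty (fun=> hnormp_ge0 _))[M fgM]]; split.
  move=> k; rewrite (_ : (fun n => _) = fun n => hnorm (Td k (f n - g n))) //.
  by apply/funext => n; rewrite !linearB hdistC.
apply/(ereal_sup_range_lty (fun=> hnormp_ge0 _)); exists M => n.
apply: le_trans (fgM n); apply: (sq_mono N_solid) => k.
by rewrite /analysis !linearB hdistC.
Qed.

Lemma hinf_equiv_trans f g h :
  hinf_equiv Td w f g -> hinf_equiv Td w g h -> hinf_equiv Td w f h.
Proof.
move=> [fg /(ereal_sup_range_lty (fun=> hnormp_ge0 _))[M fgM]].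
move=> [gh /(ereal_sup_range_lty (fun=> hnormp_ge0 _))[M' ghM]].
have fghE n : f n - h n = (f n - g n) + (g n - h n) by rewrite addrA subrK.
have [K _ tri] := sq_triangle N_solid; split=> [k|].
  apply/cvgr0Pnorm_lt => e e0; have e2 : 0 < e / 2 by rewrite divr_gt0.
  have /cvgr0Pnorm_lt/(_ _ e2) fgk := fg k.
  have /cvgr0Pnorm_lt/(_ _ e2) ghk := gh k.
  apply: filterS2 fgk ghk => n; rewrite !ger0_norm ?hnorm_ge0// => fgn ghn.
  rewrite fghE linearD [e]splitr; apply: le_lt_trans (hnorm_triangle _ _) _.
  exact: ltrD.
apply/(ereal_sup_range_lty (fun=> hnormp_ge0 _)); exists (K * (M + M')) => n.
rewrite fghE; apply: le_trans (tri _ _ _ _ (fgM n) (ghM n)).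
by apply: (sq_mono N_solid) => k; rewrite /analysis linearD.
Qed.

(** * Coefficients of a bounded class and of its partial sums *)

Section Expansion.
Variables (f : nat -> H) (c : I -> H) (M : R).
Hypothesis fc : forall k, Td k (f n) @[n --> \oo] --> c k.
Hypothesis fM : forall n, (N (analysis Td (f n)) <= M%:E)%E.
Hypothesis cM : (N c <= M%:E)%E.

(** Since [G] fixes the coefficients of each [f n], the sequence [Td k (f n)] converges both to
    [c k] and, by [G_cvg], to [G c k]. *)
Lemma hinf_fixed : G c = c.
Proof.
apply/funext => k.
suff Gck : Td k (f n) @[n --> \oo] --> G c k.
  exact: hnorm_cvg_unique Gck (@fc k).
rewrite (_ : (fun n => Td k (f n)) = fun n => G (analysis Td (f n)) k).
  exact: G_cvg fM cM fc.
by apply/funext => n; rewrite /G gram_analysis.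
Qed.

Lemma N_restrict_le J : (N (restrict J c) <= M%:E)%E.
Proof.
apply: le_trans cM; apply: (sq_mono N_solid) => k; rewrite /restrict.
by case: ifP => // _; rewrite hnorm0 hnorm_ge0.
Qed.

Variable J : nat -> {fset I}.
Hypothesis J_exhausts : nested_exhaustion J.

Lemma synthesis_coords k :
  Td k (finite_synthesis T c (J n)) @[n --> \oo] --> c k.
Proof.
rewrite -[in X in _ --> X]hinf_fixed.
have JJ m n : (m <= n)%N -> (J m `<=` J n)%fset.
  move=> /subnK <-; elim: (n - m)%N => [|i IH]; first exact: fsubset_refl.
  exact: fsubset_trans IH (J_exhausts.1 _).
have Jc l : restrict (J n) c l @[n --> \oo] --> c l.
  have [m lm] := J_exhausts.2 l.
  apply: cvg_near_cst; exists m => // n /= mn.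
  by rewrite /restrict (fsubsetP (JJ _ _ mn)).
rewrite (_ : (fun n => Td k _) = fun n => G (restrict (J n) c) k).
  exact: G_cvg (fun n => N_restrict_le (J n)) cM Jc.
by apply/funext => n; rewrite /G gram_finite_synthesis.
Qed.

Lemma equiv_synthesis :
  hinf_equiv Td w f (fun n => finite_synthesis T c (J n)).
Proof.
split=> [k|].
  have : Td k (f n - finite_synthesis T c (J n)) @[n --> \oo] --> (0 : H).
    under eq_fun do rewrite linearB; rewrite -(subrr (c k)).
    by apply: cvgB; [exact: fc|exact: synthesis_coords].
  move=> /cvg_hnormP Td0; apply/cvgr0Pnorm_lt => e /Td0; apply: filterS => n.
  by rewrite subr0 ger0_norm// hnorm_ge0.
have [K _ tri] := sq_triangle N_solid.
apply/(ereal_sup_range_lty (fun=> hnormp_ge0 _)); exists (K * (M + C * M)) => n.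
rewrite /hnormp analysisB -gram_finite_synthesis; apply: tri (@fM n) _.
rewrite (sq_opp _ N_solid); exact/G_bound/N_restrict_le.
Qed.

End Expansion.

Lemma Hinf_expansion F : Hinf Td w F ->
  hinf_sum Td w (fun k => adj (T k) (ext_coef Td F k)) F /\
  sigma_unconditional_sum Td (fun k => adj (T k) (ext_coef Td F k)) F.
Proof.
move=> [f [/choice[c fc] /(ereal_sup_range_lty (fun=> hnormp_ge0 _))[M fM]] FE].
have M0 : 0 <= M by rewrite -lee_fin (le_trans _ (fM 0%N))// hnormp_ge0.
have [K K0 fatou] := sq_fatou N_solid.
(* The Fatou property requires a positive bound and [M] may be 0, hence [M + 1]. *)
have cK : (N c <= (K * (M + 1))%:E)%E.
  apply: (fatou (fun n => analysis Td (f n))) => //; first by rewrite ltr_wpDl.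
  by apply: nearW => n; apply: le_trans (fM n) _; rewrite lee_fin lerDl.
have KM0 : 0 <= K * (M + 1) by rewrite mulr_ge0 ?addr_ge0 // ltW.
(* A single bound has to cover both the sequence and its limit. *)
have cM : (N c <= (M + K * (M + 1))%:E)%E.
  by apply: le_trans cK _; rewrite lee_fin lerDr.
have {}fM n : (N (analysis Td (f n)) <= (M + K * (M + 1))%:E)%E.
  by apply: le_trans (fM n) _; rewrite lee_fin lerDl.
have FP g : F g -> forall k, Td k (g n) @[n --> \oo] --> c k.
  rewrite FE => -[fg _] k.
  have fg0 : Td k (f n - g n) @[n --> \oo] --> (0 : H).
    by apply/cvg_hnorm0P; exact: fg.
  rewrite -[c k]subr0.
  rewrite (_ : (fun n => Td k (g n)) = fun n => Td k (f n) - Td k (f n - g n)).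
    exact: cvgB.
  by apply/funext => n; rewrite linearB opprB addrC subrK.
have Ff : F f by rewrite FE; exact: hinf_equiv_refl.
have -> : ext_coef Td F = c.
  apply/funext => k; apply: get_unique => /=.
    by move=> g Fg; exact: FP.
  by move=> d /(_ f Ff) fd; exact: hnorm_cvg_unique fd (fc k).
split=> [J JE|J JE g Fg y /H00P[u [J0 ->]]].
  have fs := equiv_synthesis fc fM cM JE.
  rewrite FE; apply/seteqP; split=> g; last exact: hinf_equiv_trans.
  exact/hinf_equiv_trans/hinf_equiv_sym.
(* [L k] is determined by the limit [c k] of the [k]-th coefficients alone. The partial sums and the
   representative [g] have the same coefficient limits, so their pairings with the test vector have
   the same limit. *)
have /choice[L LP] := fun k => inner_adj_cvg (Td k) (c k) (u k).
exists (\sum_(k <- J0) L k).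
have innerE x : inner x (finite_synthesis Td u J0) =
    \sum_(k <- J0) inner x (adj (Td k) (u k)).
  by rewrite /finite_synthesis partial_sumE raddf_sum.
have inner_lim (x_ : nat -> H) : (forall k, Td k (x_ n) @[n --> \oo] --> c k) ->
    (inner (x_ n) (finite_synthesis Td u J0) : R[i]^o) @[n --> \oo] -->
    (\sum_(k <- J0) L k : R[i]^o).
  move=> xc; under eq_fun do rewrite innerE.
  apply: cvg_big => [|k _]; first exact: add_continuous.
  exact: LP.
split; last by apply: inner_lim; exact: FP.
apply: (inner_lim (fun n => finite_synthesis T c (J n))) => k.
exact: (synthesis_coords fc fM cM JE).
Qed.

End InfiniteExponent.

(** * Solidity and admissibility *)

Section ScalarOperators.
Variables (R : realType) (H : hilbertType R).

Lemma bop_scale_continuous (r : R) : continuous (r%:C \*: idfun : {linear H -> H}).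
Proof. exact: scaler_continuous. Qed.

Definition bop_scale (r : R) : bounded_op H := BoundedOp (@bop_scale_continuous r).

(** An inequality is all that solidity asks for; equality would fail on the zero space when
    [r > 0]. *)
Lemma opnorm_scale_le (r : R) : 0 <= r -> opnorm (bop_scale r) <= r.
Proof.
move=> r0; apply: ge_sup; first by have [] := opnorm_has_sup (bop_scale r).
move=> _ [x /= x1 <-]; rewrite [hnorm _]hnormZ ger0_norm//.
by rewrite -[leRHS]mulr1 ler_wpM2l.
Qed.

End ScalarOperators.

Lemma sum_fsetB (V : zmodType) (I : choiceType) (J0 J : {fset I}) (x : I -> V) :
  (J0 `<=` J)%fset ->
  \sum_(l <- J) x l - \sum_(l <- J0) x l = \sum_(l <- (J `\` J0)%fset) x l.
Proof.
move=> J0J; rewrite (big_fsetID _ (mem J0) J) /=.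
have -> : [fset l in J | l \in J0]%fset = J0.
  apply/fsetP => l; rewrite !inE /=.
  by case: (boolP (l \in J0)) => [/(fsubsetP J0J) ->|_]; rewrite ?andbF.
have -> : [fset l in J | l \notin J0]%fset = (J `\` J0)%fset.
  by apply/fsetP => l; rewrite !inE /= andbC.
by rewrite addrAC subrr add0r.
Qed.

Section Algebra.
Variables (R : realType) (H : hilbertType R) (I : choiceType).
Variables (AA : mx_banach_star_algebra H I) (p0 : R) (w : I -> R).
Hypothesis w_gt0 : forall k, 0 < w k.
Hypothesis AA_spectral : spectral_algebra AA.
Hypothesis w_admissible : admissible AA p0 w.

(* By solidity the matrix of scalar operators [opnorm (A k l)] is in the
   algebra; applying it to a bounded sequence with all [w l * f l] equal shows
   that [opnorm (A k l) / w l] is summable in [l]. *)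
Lemma algebra_dominated (a : AA) k (e : R) : 0 < e -> exists J0 : {fset I},
  forall (u : I -> H) (m : R) J,
  (linf_norm w u <= m%:E)%E -> (J0 `<=` J)%fset ->
  hnorm (\sum_(l <- J) coefs a k l (u l) - \sum_(l <- J0) coefs a k l (u l))
    <= e * m.
Proof.
(* The test sequence needs a nonzero vector, so the zero space is treated apart. *)
move=> e0; have [[x x0]|trivH] := pselect (exists x : H, x != 0); last first.
  have H0 (x : H) : x = 0.
    by apply: contrapT => /eqP x0; apply: trivH; exists x.
  exists fset0 => u m J /(sq_bound_ge0 (linf_solid_quasinorm H w_gt0)) m0 _.
  by rewrite [X in hnorm X]H0 hnorm0 mulr_ge0// ltW.
have hx0 : 0 < hnorm x.
  rewrite lt_neqAle hnorm_ge0 andbT eq_sym; apply: contra_neq x0.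
  exact: hnorm0_eq0.
pose B k l := bop_scale H (opnorm (coefs a k l)).
have [b bB _] : exists2 b : AA, (forall k l h, coefs b k l h = B k l h) &
    `|b| <= `|a|.
  by apply: sa_solid AA_spectral _ _ _ => k' l; exact/opnorm_scale_le/opnorm_ge0.
pose f l : H := (w l)^-1%:C *: x.
have ellf : ell +oo%E w f.
  rewrite /ell /=; apply: le_lt_trans (ltry (hnorm x)).
  apply/linf_normP; first exact: hnorm_ge0.
  move=> l; rewrite hnormZ ger0_norm ?invr_ge0 ?(ltW (w_gt0 l))//.
  by rewrite mulrAC mulVf ?mul1r// gt_eqF.
have [s bs] := (w_admissible b (or_introl (ltry p0))).1 f ellf k.
pose q l := opnorm (coefs a k l) / w l.
have q0 l : 0 <= q l by rewrite divr_ge0 ?opnorm_ge0// ltW.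
have bE J : summability.partial_sum (fun l => coefs b k l (f l)) J =
    (\sum_(l <- J) q l)%:C *: x.
  rewrite partial_sumE rmorph_sum scaler_suml; apply: eq_bigr => l _.
  by rewrite bB /= scalerA -rmorphM.
(* Two partial sums this close to [s] differ by at most [e * hnorm x], and their difference is the
   sum of [q] over the added indices times [x]; dividing by [hnorm x] leaves [e]. *)
have d0 : 0 < e * hnorm x / 2 by rewrite divr_gt0// mulr_gt0.
have [J0 sJ0] := (unconditional_sumP _ _).1 bs _ d0.
exists J0 => u m J um J0J; have m0 := sq_bound_ge0 (linf_solid_quasinorm H w_gt0) um.
have qJ : \sum_(l <- (J `\` J0)%fset) q l <= e.
  rewrite -(ler_pM2r hx0) -[leLHS]ger0_norm; last first.
    by rewrite mulr_ge0 ?hnorm_ge0// sumr_ge0.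
  rewrite normrM (ger0_norm (hnorm_ge0 x)) -hnormZ -sum_fsetB//.
  rewrite rmorphB scalerBl -!bE [leRHS]splitr.
  have /ltW h1 := sJ0 J J0J; have /ltW h2 := sJ0 J0 (fsubset_refl _).
  rewrite hdistC in h2; apply: le_trans (lerD h1 h2).
  by apply: le_trans (hnorm_triangle _ _); rewrite addrA subrK.
rewrite sum_fsetB//; apply: le_trans (hnorm_sum _ _) _.
apply: le_trans (_ : \sum_(l <- (J `\` J0)%fset) q l * m <= _); last first.
  by rewrite -mulr_suml ler_wpM2r.
apply: ler_sum => l _; apply: le_trans (hnorm_le_opnorm _ _) _.
rewrite /q -mulrA ler_wpM2l ?opnorm_ge0// mulrC ler_pdivlMr//.
exact: (linf_normP _ _ m0).1.
Qed.

(** For [q != 0] membership in [ell] is just finiteness of the norm. The constant becomes the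
    absolute value of [C], as the sign of [C] is unknown and the bound must be monotone in [a]. *)
Lemma defines_bounded_bound (q : \bar R) (A : opmatrix H I) : q != 0%E ->
  solid_quasinorm w (@lp_norm R H I q w) -> defines_bounded q w A ->
  exists C : R, forall (u : I -> H) (a : R),
    (lp_norm q w u <= a%:E)%E -> (lp_norm q w (mxact A u) <= (C * a)%:E)%E.
Proof.
move=> q0 sN [_ [_ _ [C AC]]]; exists `|C| => u a ua.
have Nfin : (lp_norm q w u < +oo)%E := le_lt_trans ua (ltry a).
have ellu : ell q w u by rewrite /ell (negPf q0).
apply: le_trans (AC u ellu) _.
have NE : lp_norm q w u = (fine (lp_norm q w u))%:E.
  by rewrite fineK// ge0_fin_numE// (sq_ge0 u sN).
have N0 := sq_ge0 u sN; move: ua N0; rewrite NE -EFinM !lee_fin => ua N0.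
apply: le_trans (ler_wpM2r N0 (ler_norm C)) _.
by rewrite ler_wpM2l.
Qed.

Lemma defines_bounded_sub (q : \bar R) (A : opmatrix H I) (u v : I -> H) :
  q != 0%E -> defines_bounded q w A ->
  (lp_norm q w u < +oo)%E -> (lp_norm q w v < +oo)%E ->
  mxact A (u - v) = mxact A u - mxact A v.
Proof.
move=> q0 [_ [_ Alin _]] uoo voo.
have [ellu ellv] : ell q w u /\ ell q w v by rewrite /ell (negPf q0).
by have := Alin (-1) v u ellv ellu; rewrite !scaleN1r ![- _ + _]addrC.
Qed.

End Algebra.

(** * Combination of the cases [p = 0], finite positive [p] and [p = +oo] *)

Theorem theorem3p21 (R : realType) (H : hilbertType R) (d : nat)
    (X : set 'rV[R]_d) (AA : mx_banach_star_algebra H X) (p0 : R)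
    (omega : 'rV[R]_d -> R) (T Td : X -> bounded_op H) :
  separable H ->
  countable X ->
  spectral_algebra AA ->
  0 < p0 -> p0 <= 1 ->
  weight omega ->
  admissible AA p0 (fun k : X => omega (val k)) ->
  g_frame T ->
  dual_g_frame T Td ->
  sim_algebra AA Td T ->
  forall p : \bar R, (p0%:E < p)%E \/ p = 0%E \/ p = 1%E ->
    let w := fun k : X => omega (val k) in
    ((p < +oo)%E -> forall F, Hp Td T w p F ->
       hp_unconditional_sum Td T w p
         (fun k => adj (T k) (ext_coef Td F k)) F) /\
    (p = +oo%E -> forall F, Hinf Td w F ->
       hinf_sum Td w (fun k => adj (T k) (ext_coef Td F k)) F /\
       sigma_unconditional_sum Td (fun k => adj (T k) (ext_coef Td F k)) F).
Proof.
move=> _ _ AA_spectral p0_gt0 _ [_ omega_gt0] adm _ [_ T_dual _] [a aE] p p_adm w.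
have w_gt0 k : 0 < w k by exact: omega_gt0.
have aG : mxact (coefs a) = mxact (gram Td T).
  apply/funext => u; apply/funext => k; rewrite /mxact.
  by congr summability.sum; apply/funext => l; exact: aE.
(* Admissibility always covers the exponents infinity and 1: the first serves [p = +oo] and [p = 0],
   the second the tails for [p = 0]. *)
have adm_oo := adm a +oo%E (or_introl (ltry p0)).
have adm_1 := adm a 1%E (or_intror erefl).
have linf_solid := linf_solid_quasinorm H w_gt0.
have [Coo Goo] := defines_bounded_bound (q := +oo) isT linf_solid adm_oo.
split=> [p_fin F FHp|_ F FHinf].
  have [p_eq0|p_neq0] := eqVneq p 0%E.
    subst p.
    have linf0 : @lp_norm R H X 0%E w = linf_norm w.
      by apply/funext => u; rewrite /lp_norm /= eqxx.
    have l1_solid := lp_solid_quasinorm H w_gt0 ltr01.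
    have [C1 G1] := defines_bounded_bound (q := 1%E) (oner_neq0 _) l1_solid adm_1.
    apply: (Hp_expansion w_gt0 _ (C := Coo) _ _ _ _ T_dual FHp).
    - by rewrite linf0.
    - by move=> u b; rewrite linf0 -aG; exact: Goo.
    - by move=> u v; rewrite linf0 -aG; exact: defines_bounded_sub adm_oo.
    - move=> J u; rewrite linf0.
      exact: le_lt_trans (linf_le_lp w_gt0 ltr01 _) (lp_restrict_lty w ltr01 J u).
    (* A finitely supported sequence lies in l^1, so its image under the Gram matrix does too; tails
       vanish in l^1 and therefore in the smaller sup norm. *)
    - move=> J u e e0; rewrite linf0 -aG.
      have l1fin := lp_restrict_lty w ltr01 J u.
      have [G1fin _ _] := adm_1.2.
      have [|J0 J0P] := lp_vanishing_tails (w := w)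
        (u := mxact (coefs a) (restrict J u)) ltr01 _ e0.
        by have := G1fin (restrict J u); rewrite /ell onee_eq0; apply.
      exists J0 => J' /J0P; apply: le_trans; exact: linf_le_lp.
  have p_adm' : (p0%:E < p)%E \/ p = 1%E.
    by case: p_adm => [|[]]; [left|move/eqP: p_neq0|right].
  have [r r_gt0 pE] : exists2 r : R, 0 < r & p = r%:E.
    case: p_adm' p_fin => [|->]; last by exists 1.
    case: p {p_adm FHp p_neq0} => [r||]//; rewrite lte_fin => p0r _.
    by exists r => //; exact: lt_trans p0r.
  subst p; have lp_solid := lp_solid_quasinorm H w_gt0 r_gt0.
  have adm_p := adm a _ p_adm'.
  have [C GC] := defines_bounded_bound p_neq0 lp_solid adm_p.
  apply: (Hp_expansion w_gt0 lp_solid (C := C) _ _ _ _ T_dual FHp).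
  - by rewrite -aG.
  - by move=> u v; rewrite -aG; exact: defines_bounded_sub adm_p.
  - by move=> J u; exact: lp_restrict_lty.
  - move=> J u; rewrite -aG; apply: lp_vanishing_tails => //.
    have ellJ : ell r%:E w (restrict J u).
      by rewrite /ell (negPf p_neq0); exact: lp_restrict_lty.
    by have [] := adm_p.2; move=> /(_ _ ellJ); rewrite /ell (negPf p_neq0).
have aG' u k : (fun l => gram Td T k l (u l)) = (fun l => coefs a k l (u l)).
  by apply/funext => l; rewrite aE.
apply: (Hinf_expansion w_gt0 (C := Coo) _ _ _ T_dual FHinf).
- by rewrite -aG.
- by move=> u k uoo; rewrite aG'; exact: adm_oo.1.
- move=> k e e0; have [J0 J0P] := algebra_dominated w_gt0 AA_spectral adm a k e0.
  exists J0 => u b J ub J0J; have := J0P u b J ub J0J.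
  by under eq_bigr do rewrite aE; under [X in _ - X]eq_bigr do rewrite aE.
Qed.
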